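(* Let $(X,d,G)$ be a $G$-system with $\underline{\mathrm{mdim}}_M(G,X,d)<\infty$, and let $\{F_n\}$ be a tempered Følner sequence of $G$. If $$\underline{\mathrm{mdim}}_M(G,X,f,d)=\max_{\mu\in M(X,G)}\Big\{\underline{\mathrm{mdim}}_M(\mu,\{F_n\},d)+\int f\,d\mu\Big\}\quad\text{for all }f\in C(X,\mathbb R),$$ then for every $\mu_0\in M(X,G)$, $$\underline{\mathrm{mdim}}_M(\mu_0,\{F_n\},d)=\inf_{f\in C(X,\mathbb R)}\Big\{\underline{\mathrm{mdim}}_M(G,X,f,d)-\int f\,d\mu_0\Big\}.$$
   Context: $G$ is a countably infinite discrete amenable group; $(X,d,G)$ a compact metric space with continuous $G$-action by homeomorphisms. Følner: nonempty finite $F_n$ with $|gF_n\triangle F_n|/|F_n|\to0$; tempered: $|\bigcup_{j<n}F_j^{-1}F_n|\le C|F_n|$. $d_F(x,y)=\max_{g\in F}d(gx,gy)$, $S_Ff(x)=\sum_{g\in F}f(gx)$, $P_F(X,f,d,\epsilon)=\sup\{\sum_{x\in E}e^{S_Ff(x)}:E\subset X$ with pairwise $d_F$-distances $>\epsilon\}$, $P(X,f,d,\{F_n\},\epsilon)=\limsup_n\frac1{|F_n|}\log P_{F_n}(X,f,d,\epsilon)$, $\underline{\mathrm{mdim}}_M(G,X,f,d)=\liminf_{\epsilon\to0}\frac{P(X,f\log(1/\epsilon),d,\{F_n\},\epsilon)}{\log(1/\epsilon)}$, $\underline{\mathrm{mdim}}_M(G,X,d)=\underline{\mathrm{mdim}}_M(G,X,0,d)$.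 $M(X,G)$: invariant Borel probability measures (weak* ); $E(X,G)$: ergodic; $\mathrm{co}(E(X,G))$: finite convex combinations $\mu=\sum_j\lambda_j\mu_j$ (unique, distinct ergodic $\mu_j$, $\lambda_j>0$). For ergodic $\nu$, $h_\nu(\epsilon)=\inf\{h_\nu(G,\alpha):\alpha$ finite Borel partition, $\mathrm{diam}(\alpha)\le\epsilon\}$ where $h_\nu(G,\alpha)=\lim_n\frac1{|F_n|}H_\nu(\bigvee_{g\in F_n}g^{-1}\alpha)$; $F(\mu,\epsilon)=\sum_j\lambda_jh_{\mu_j}(\epsilon)$. $M_G(\mu)$: families $(\mu_\epsilon)_{\epsilon>0}\subset\mathrm{co}(E(X,G))$ with $\mu_\epsilon\to\mu$ weak* as $\epsilon\to0$. $\underline{\mathrm{mdim}}_M(\mu,\{F_n\},d)=\sup_{(\mu_\epsilon)\in M_G(\mu)}\liminf_{\epsilon\to0}F(\mu_\epsilon,\epsilon)/\log\frac1\epsilon$. *)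

(* Defs.v *)
From HB Require Import structures.
From mathcomp Require Import all_boot all_order all_algebra finmap.
From mathcomp Require Import all_classical all_reals all_analysis.
Set Implicit Arguments. Unset Strict Implicit. Unset Printing Implicit Defensive.
Import Order.TTheory GRing.Theory Num.Theory.
Import numFieldNormedType.Exports.
Local Open Scope classical_set_scope.
Local Open Scope ring_scope.

(** nonempty metric spaces (pointed metric types); nonemptiness is harmless
    since the conclusion quantifies over a probability measure on X. *)
#[short(type="pmetricType")]
HB.structure Definition PointedMetric (K : numDomainType) :=
  { M of Metric K M & Pointed M }.

Record group_law (G : Type) := GroupLaw {
  gmul : G -> G -> G; gone : G; ginv : G -> G;
  gmulA : forall a b c, gmul a (gmul b c) = gmul (gmul a b) c;
  gmul1 : forall a, gmul gone a = a;
  gmulV : forall a, gmul (ginv a) a = gone }.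

Definition is_gaction (G : Type) (L : group_law G) (X : topologicalType)
  (act : G -> X -> X) :=
  [/\ forall x, act (gone L) x = x,
      forall g h x, act (gmul L g h) x = act g (act h x)
    & forall g, continuous (act g)].

Definition ltrans (G : choiceType) (L : group_law G) (g : G) (F : {fset G}) :
  {fset G} := [fset gmul L g h | h in F]%fset.

Definition folner (R : realType) (G : choiceType) (L : group_law G)
  (F : nat -> {fset G}) :=
  (forall n, F n != fset0) /\
  forall g : G,
    (fun n => (#|` ((ltrans L g (F n) `\` F n) `|` (F n `\` ltrans L g (F n)))%fset|%:R
               / #|` F n|%:R : R)) @ \oo --> (0 : R).

Definition tempered (R : realType) (G : choiceType) (L : group_law G)
  (F : nat -> {fset G}) :=
  exists C : R, forall n,
    (#|` (\big[fsetU/fset0]_(j < n) [fset gmul L (ginv L a) b | a in F j, b in F n])%fset|%:R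
      <= C * #|` F n|%:R).

Section Pressure.
Variables (R : realType) (G : choiceType) (X : pmetricType R).

Definition bowen (act : G -> X -> X) (F : {fset G}) (x y : X) : R :=
  \big[Num.max/0]_(g <- F) mdist (act g x) (act g y).

Definition birk (act : G -> X -> X) (f : X -> R) (F : {fset G}) (x : X) : R :=
  \sum_(g <- F) f (act g x).

Definition bsep (act : G -> X -> X) (F : {fset G}) (eps : R)
  (E : {fset X}) :=
  forall x y, x \in E -> y \in E -> x <> y -> eps < bowen act F x y.

Definition PF (act : G -> X -> X) (f : X -> R) (F : {fset G}) (eps : R) : R :=
  sup [set \sum_(x <- E) expR (birk act f F x)
      | E in [set E : {fset X} | bsep act F eps E]].

Definition Ppress (act : G -> X -> X) (f : X -> R) (Fs : nat -> {fset G})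
  (eps : R) : \bar R :=
  limn_esup (fun n => (ln (PF act f (Fs n) eps) / #|` Fs n|%:R)%:E).

End Pressure.

Definition liminf0 (R : realType) (g : R -> \bar R) : \bar R :=
  ereal_sup [set ereal_inf [set g e | e in `]0, d[ ] | d in `]0, +oo[ ].

Definition mdimM (R : realType) (G : choiceType) (X : pmetricType R)
  (act : G -> X -> X) (f : X -> R) (Fs : nat -> {fset G}) : \bar R :=
  liminf0 (fun e : R => Ppress act (fun x => (f x * ln e^-1)%R) Fs e
                        * ((ln e^-1)^-1)%:E)%E.

Notation XB X := (g_sigma_algebraType (@open X)).

Section Measures.
Variables (R : realType) (G : choiceType) (X : pmetricType R).

Definition inv_measure (act : G -> X -> X) (mu : probability (XB X) R) :=
  forall (g : G) (A : set (XB X)), measurable A -> mu (act g @^-1` A) = mu A.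

Definition erg_measure (act : G -> X -> X) (mu : probability (XB X) R) :=
  inv_measure act mu /\
  forall A : set (XB X), measurable A -> (forall g, act g @^-1` A = A) ->
    mu A = 0%E \/ mu A = 1%E.

(** int f dmu  (finite for continuous f on compact X) *)
Definition integ (mu : probability (XB X) R) (f : X -> R) : R :=
  fine (\int[mu]_x (f x)%:E).

Definition is_partition n (A : 'I_n -> set (XB X)) :=
  [/\ forall i, measurable (A i),
      forall i j, i != j -> A i `&` A j = set0
    & \bigcup_(i in setT) A i = setT].

Definition diam_le n (A : 'I_n -> set (XB X)) (eps : R) :=
  forall i (x y : X), A i x -> A i y -> mdist x y <= eps.

Definition xlnx (t : R) : R := t * ln t.

Definition Hjoin (act : G -> X -> X) (mu : probability (XB X) R) n
  (A : 'I_n -> set (XB X)) (F : {fset G}) : R :=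
  - \sum_(s : {ffun F -> 'I_n})
      xlnx (fine (mu [set x : (XB X) | forall g : F, A (s g) (act (val g) x)])).

Definition hpart (act : G -> X -> X) (mu : probability (XB X) R) n
  (A : 'I_n -> set (XB X)) (Fs : nat -> {fset G}) : R :=
  limn (fun k => Hjoin act mu A (Fs k) / #|` Fs k|%:R).

Definition heps (act : G -> X -> X) (Fs : nat -> {fset G})
  (mu : probability (XB X) R) (eps : R) : R :=
  inf [set r | exists n (A : 'I_n -> set (XB X)),
        [/\ is_partition A, diam_le A eps & r = hpart act mu A Fs]].

Unset Implicit Arguments.
Record cvx := Cvx {
  cv_n : nat; cv_lam : 'I_cv_n -> R; cv_nu : 'I_cv_n -> probability (XB X) R }.
Set Implicit Arguments.

(** membership in co(E(X,G)) with the canonical representation *)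
Definition in_coE (act : G -> X -> X) (c : cvx) :=
  [/\ forall i, 0 < cv_lam c i,
      \sum_i cv_lam c i = 1,
      forall i, erg_measure act (cv_nu c i)
    & forall i j, i != j ->
        (cv_nu c i : set (XB X) -> \bar R) <> (cv_nu c j : set (XB X) -> \bar R)].

Definition Fval (act : G -> X -> X) (Fs : nat -> {fset G}) (c : cvx) (eps : R) : R :=
  \sum_i cv_lam c i * heps act Fs (cv_nu c i) eps.

Definition weak_conv0 (fam : R -> cvx) (mu : probability (XB X) R) :=
  forall f : X -> R, continuous f ->
    (fun e => \sum_i cv_lam (fam e) i * integ (cv_nu (fam e) i) f)
      @ 0^'+ --> integ mu f.

Definition MG (act : G -> X -> X) (mu : probability (XB X) R) (fam : R -> cvx) :=
  (forall e, 0 < e -> in_coE act (fam e)) /\ weak_conv0 fam mu.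

Definition mdim_mu (act : G -> X -> X) (Fs : nat -> {fset G})
  (mu : probability (XB X) R) : \bar R :=
  ereal_sup [set liminf0 (fun e : R => (Fval act Fs (fam e) e / ln e^-1)%:E)
            | fam in MG act mu].

End Measures.

(* Main.v *)
Require Import Defs.
From HB Require Import structures.
From mathcomp Require Import all_boot all_order all_algebra finmap.
From mathcomp Require Import all_classical all_reals all_analysis.
From mathcomp Require Import lra ring measurable_realfun.
Import Order.TTheory GRing.Theory Num.Theory.
Import numFieldNormedType.Exports.
Local Open Scope classical_set_scope.
Local Open Scope ring_scope.
Set Implicit Arguments.
Unset Strict Implicit.
Unset Printing Implicit Defensive.

(** One inequality is immediate from the variational principle.  For the other
    one, let [a] be a real lower bound of [mdimM f - int f dmu0] over continuous
    [f].  Given finitely many continuous [phi i], the pairs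
    [(int phi i dnu - int phi i dmu0)_i, t], with [nu] in co(E) depending on the
    scale [e] and [t] at most the entropy rate of [nu] as [e] tends to [0], form
    a convex set.  Maximising [t - A |x|^2] over it, the variational principle
    applied to the linearisation at a near-maximiser shows that this set comes
    arbitrarily close to [(0, a)]; no separation theorem or upper
    semicontinuity is needed.  Taking for [phi] partitions of unity of smaller
    and smaller mesh and diagonalising over [e] yields a family in co(E) that
    converges weakly to [mu0] with lower entropy rate at least [a]. *)

(** * Convex optimisation in finite dimension *)

(** [x, t] is a near-minimiser of [A |x|^2 - t] on [K], and [y, s] the point
    that the last hypothesis gives for [2 A x], i.e. for the gradient at [x].
    Moving from [x, t] towards [y, s] cannot gain much, which bounds
    [a - t + 2 A |x|^2]. *)
Lemma frank_wolfe (R : realType) (m : nat) (K : ('I_m -> R) -> R -> Prop)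
    (M a : R) :
  (forall x t, K x t -> t <= M /\ forall i, `|x i| <= 1) ->
  (forall x t y s tau, 0 < tau < 1 -> K x t -> K y s ->
     K (fun i => x i + tau * (y i - x i)) (t + tau * (s - t))) ->
  (forall b : 'I_m -> R, exists x t, K x t /\ a + \sum_i b i * x i <= t) ->
  forall d : R, 0 < d ->
    exists x t, [/\ K x t, a - d <= t & forall i, `|x i| <= d].
Proof.
move=> Kb Kconv Ka d d0.
pose Q (x : 'I_m -> R) := \sum_i x i ^+ 2.
have Q0 x : 0 <= Q x by apply: sumr_ge0 => i _; exact: sqr_ge0.
(* With this penalty, [2 * A * Q x < d + M - a] forces [Q x <= d ^+ 2]. *)
pose A := (d + `|M - a| + 1) / (2 * d ^+ 2).
have A0 : 0 < A.
  by rewrite /A divr_gt0 ?mulr_gt0 ?exprn_gt0// ltr_wpDl// addr_ge0// ltW.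
have AE : 2 * A * d ^+ 2 = d + `|M - a| + 1.
  by rewrite /A; field; rewrite gt_eqF.
(* Bounds [|y - x|^2]: both points lie in the cube of coordinates between -1 and 1. *)
pose B : R := 4 * m%:R.
have B0 : 0 <= B by rewrite /B mulr_ge0.
(* The step length is below 1 and so short that the second-order term [tau * (A * B)] stays below
   [d / 2]. *)
pose tau := d / (2 * (1 + d + A * B)).
have AB0 : 0 <= A * B by rewrite mulr_ge0// ltW.
have D0 : 0 < 2 * (1 + d + A * B) by lra.
have tau0 : 0 < tau by rewrite divr_gt0.
have tau1 : tau < 1 by rewrite /tau ltr_pdivrMr//; lra.
have tauB : tau * (A * B) <= d / 2.
  have : tau * (2 * (1 + d + A * B)) = d by rewrite divfK// gt_eqF.
  have : 0 <= tau * (1 + d) by rewrite mulr_ge0//; lra.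
  lra.
pose S := [set j : R | exists x t, K x t /\ j = A * Q x - t].
have Sinf : has_inf S.
  split.
    have [x [t [Kxt _]]] := Ka (fun=> 0).
    by exists (A * Q x - t); exists x, t.
  exists (- M) => _ [x [t [Kxt ->]]].
  have [tM _] := Kb _ _ Kxt.
  have : 0 <= A * Q x by rewrite mulr_ge0// ltW.
  lra.
have eta0 : 0 < tau * (d / 2) by rewrite mulr_gt0// divr_gt0.
have [_ [x [t [Kxt ->]]] Jlt] := inf_adherent eta0 Sinf.
have [tM x1] := Kb _ _ Kxt.
have [y [s [Kys as_]]] := Ka (fun i => 2 * A * x i).
have [_ y1] := Kb _ _ Kys.
have taub : 0 < tau < 1 by rewrite tau0.
have Knew := Kconv _ _ _ _ _ taub Kxt Kys.
have Jle : inf S <=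
    A * Q (fun i => x i + tau * (y i - x i)) - (t + tau * (s - t)).
  apply: ge_inf; first by case: Sinf.
  by exists (fun i => x i + tau * (y i - x i)), (t + tau * (s - t)).
pose P := \sum_i x i * y i.
pose W := \sum_i (y i - x i) ^+ 2.
have QE : Q (fun i => x i + tau * (y i - x i)) =
    Q x + 2 * tau * (P - Q x) + tau ^+ 2 * W.
  rewrite /Q /P /W -sumrB !mulr_sumr -!big_split/=.
  by apply: eq_bigr => i _; ring.
have WB : W <= B.
  rewrite /W /B -[m in X in _ <= X]card_ord -sumr_const mulr_sumr.
  apply: ler_sum => i _.
  have := x1 i; have := y1 i; rewrite !ler_norml => /andP[? ?] /andP[? ?].
  nra.
have PE : \sum_i 2 * A * x i * y i = 2 * A * P.
  by rewrite /P mulr_sumr; apply: eq_bigr => i _; ring.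
rewrite PE in as_; rewrite QE in Jle.
have W0 : 0 <= W by apply: sumr_ge0 => i _; exact: sqr_ge0.
(* Near-minimality costs [tau * (d / 2)] and the quadratic term as much again. The cross term [P]
   cancels against [s >= a + 2 * A * P]. *)
have key : tau * (a - t + 2 * A * Q x) < tau * d.
  have h1 : tau * (a + 2 * A * P) <= tau * s by rewrite ler_pM2l.
  have h2 : tau * (tau * (A * W)) <= tau * (d / 2).
    rewrite ler_pM2l//; apply: le_trans tauB.
    by rewrite ler_pM2l// ler_pM2l.
  lra.
rewrite ltr_pM2l// in key.
have AQ0 : 0 <= A * Q x by rewrite mulr_ge0// ltW.
exists x, t; split => //; first lra.
move=> i.
have Qlt : Q x <= d ^+ 2.
  have : 2 * A * Q x <= 2 * A * d ^+ 2.
    rewrite AE; have := ler_norm (M - a); lra.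
  by rewrite ler_pM2l// mulr_gt0.
rewrite -(@ler_pXn2r _ 2)// ?nnegrE// ?(ltW d0)//.
rewrite real_normK ?num_real//; apply: le_trans Qlt.
rewrite /Q (bigD1 i)//= lerDl; apply: sumr_ge0 => j _; exact: sqr_ge0.
Qed.

(** * Equality of probabilities and continuity of finite sums *)

(** [in_coE] separates components as set functions, whereas mixtures merge them by equality of
    packed probabilities. The remaining fields are proofs, hence equal by irrelevance. *)
Lemma eq_probability (R : realType) (d : measure_display)
    (T : measurableType d) (p q : probability T R) :
  (p : set T -> \bar R) = q -> p = q.
Proof.
case: p => P cP; case: q => Q cQ /= PQ; move: cP cQ.
rewrite PQ => -[c1 c2 c3 c4 c5 c6 c7] [d1 d2 d3 d4 d5 d6 d7].
have e1 : c1 = d1.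
  by case: c1 d1 {c2 d2} => ? ? [? ?]; f_equal; exact: Prop_irrelevance.
move: c2 d2; rewrite e1 => c2 d2.
have -> : c2 = d2 by case: c2 d2 => ? [?]; f_equal; exact: Prop_irrelevance.
have -> : c3 = d3 by case: c3 d3 => ? [?]; f_equal; exact: Prop_irrelevance.
have -> : c4 = d4 by case: c4 d4 => ? [?]; f_equal; exact: Prop_irrelevance.
have -> : c5 = d5 by case: c5 d5 => ? [?]; f_equal; exact: Prop_irrelevance.
have -> : c6 = d6 by case: c6 d6 => ? [?]; f_equal; exact: Prop_irrelevance.
by have -> : c7 = d7 by case: c7 d7 => ? [?]; f_equal; exact: Prop_irrelevance.
Qed.

Lemma continuous_sumr (R : realType) (T : topologicalType) (I : Type)
    (r : seq I) (f : I -> T -> R) :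
  (forall i, continuous (f i)) -> continuous (fun x => \sum_(i <- r) f i x).
Proof.
move=> cf x; apply: (@cvg_big _ _ +%R 0 xpredT _ _ _ r f (fun i => f i x)).
  exact: add_continuous.
by move=> i _; exact: cf.
Qed.

(** * Uniform continuity and partitions of unity on a compact metric space *)

Section compact_metric.
Variables (R : realType) (X : pmetricType R).
Hypothesis cX : compact [set: X].

Lemma continuous_mdist (y : X) : continuous (fun x : X => mdist x y).
Proof.
move=> x; apply/cvgrPdist_lt => e e0.
have : nbhs x (ball x e) by apply: nbhsx_ballx.
rewrite ballEmdist; apply: filterS => z /= xz.
have := metric_triangle z x y; have := metric_triangle x z y.
rewrite (metric_sym z x) ltr_norml; lra.
Qed.

Lemma continuous_bounded (f : X -> R) : continuous f ->
  exists2 M, 0 < M & forall x, `|f x| <= M.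
Proof.
move=> cf.
have : compact (f @` [set: X]).
  by apply: continuous_compact => //; apply: continuous_subspaceT.
move=> /compact_bounded [M [_ Mf]].
exists (`|M| + 1); first by rewrite ltr_wpDl.
move=> x; apply: (Mf (`|M| + 1)); last by exists x.
by rewrite ltr_pwDr// ler_norm.
Qed.

(** The radius may vary with the centre, as the proof of uniform continuity requires; partitions of
    unity use a constant one. *)
Lemma compact_mesh (r : X -> R) : (forall x, 0 < r x) ->
  exists s : seq X, forall x, exists2 y, y \in s & mdist y x < r y.
Proof.
move=> r0; move: cX; rewrite compact_cover.
move=> /(_ X setT (fun y => (ball y (r y))^°)).
case.
- by move=> y _; exact: open_interior.
- move=> x _; exists x => //; rewrite /interior.
  by apply: nbhsx_ballx.
- move=> D _ cov; exists (finmap.enum_fset D) => x.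
  have [y yD] := cov x I.
  move=> /interior_subset; rewrite ballEmdist /= => yx.
  by exists y.
Qed.

Lemma continuous_uniform (f : X -> R) (e : R) : continuous f -> 0 < e ->
  exists2 r, 0 < r & forall x y, mdist x y < r -> `|f x - f y| < e.
Proof.
move=> cf e0.
have e20 : 0 < e / 2 by rewrite divr_gt0.
(* The factor 2 leaves room for two steps: from the centre [z] to [x], then from [x] to [y], each
   shorter than [r z]. *)
have H x : exists r, 0 < r /\
    forall y, mdist x y < r * 2 -> `|f x - f y| < e / 2.
  have /cvgrPdist_lt/(_ _ e20) := cf x.
  rewrite -nbhs_ballE => -[r /= r0 rf]; exists (r / 2).
  split; first by rewrite divr_gt0.
  by move=> y xy; apply: rf; rewrite ballEmdist/=; lra.
have [r rP] := choice H.
have [s sP] := @compact_mesh r (fun x => (rP x).1).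
have [d d0 ds] : exists2 d, 0 < d & forall y, y \in s -> d <= r y.
  elim: s {sP} => [|z s [d d0 ds]]; first by exists 1.
  exists (Num.min (r z) d); first by rewrite lt_min d0 (rP z).1.
  move=> y; rewrite inE => /predU1P[->|/ds dy]; first by rewrite ge_min lexx.
  by rewrite ge_min dy orbT.
exists d => // x y xy; have [z zs zx] := sP x.
have h1 := (rP z).2 x; have h2 := (rP z).2 y.
have r0 := (rP z).1; have dz := ds _ zs.
have {}h1 := h1 ltac:(lra).
have {}h2 : `|f z - f y| < e / 2.
  by apply: h2; have := metric_triangle z x y; lra.
by move: h1 h2; rewrite !ltr_norml; lra.
Qed.

(** Tent functions of radius [r] around a finite [r]-net, divided by their sum; the sum is positive
    because every point is within [r] of some centre. *)
Lemma partition_of_unity (r : R) : 0 < r ->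
  exists m (p : 'I_m -> X) (phi : 'I_m -> X -> R),
    [/\ forall i, continuous (phi i), forall i x, 0 <= phi i x,
        forall x, \sum_i phi i x = 1
      & forall i x, phi i x != 0 -> mdist x (p i) < r].
Proof.
move=> r0.
have [s sP] := @compact_mesh (fun=> r) (fun=> r0).
pose p (i : 'I_(size s)) := nth point s i.
pose psi (i : 'I_(size s)) (x : X) := Num.max 0 (r - mdist x (p i)).
pose S x := \sum_i psi i x.
have psi0 i x : 0 <= psi i x by rewrite /psi le_max lexx.
have S0 x : 0 < S x.
  have [y ys yx] := sP x.
  rewrite /S lt_def sumr_ge0// andbT; apply/negP => /eqP.
  move=> /psumr_eq0P/=.
  have ys' : (index y s < size s)%N by rewrite index_mem.
  move=> /(_ (fun i _ => psi0 i x) (Ordinal ys') isT).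
  rewrite /psi /p/= nth_index// metric_sym => h.
  have := ge_max (r - mdist y x) 0 (r - mdist y x).
  have : r - mdist y x <= Num.max 0 (r - mdist y x) by rewrite le_max lexx orbT.
  by rewrite h; lra.
have cpsi i : continuous (psi i).
  move=> x; apply: (@continuous_max _ _ (fun=> 0) (fun z => r - mdist z (p i))).
    exact: cvg_cst.
  by apply: cvgB; [exact: cvg_cst | exact: continuous_mdist].
have cS : continuous S.
  by apply: continuous_sumr.
exists (size s), p, (fun i x => psi i x / S x); split.
- move=> i x; apply: cvgM; first exact: cpsi.
  by apply: cvgV; [rewrite gt_eqF | exact: cS].
- by move=> i x; rewrite divr_ge0// ltW.
- by move=> x; rewrite -mulr_suml; apply: mulfV; rewrite (gt_eqF (S0 x)).
- move=> i x; rewrite mulf_eq0 negb_or => /andP[+ _].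
  rewrite /psi; case: (ltP 0 (r - mdist x (p i))) => [h _|_]; first by lra.
  by rewrite eqxx.
Qed.

Lemma continuous_measurable (f : X -> R) : continuous f ->
  measurable_fun [set: XB X] (f : XB X -> R).
Proof.
move=> cf; apply: (measurability _ (RGenInftyO.measurableE R)).
move=> _ [_ [x ->] <-]; rewrite setTI.
apply: sub_sigma_algebra.
rewrite set_itvE/=.
by move/continuousP : cf; apply; exact: open_lt.
Qed.
End compact_metric.

(** * Convex combinations of ergodic measures *)

Section mixtures.
Variables (R : realType) (G : choiceType) (X : pmetricType R).
Implicit Types (mu : probability (XB X) R) (c : cvx R X).

(** Leaving [phi] arbitrary treats integrals of test functions and the entropy [Fval] at once. *)
Definition cvavg c (phi : probability (XB X) R -> R) : R :=
  \sum_i cv_lam R X c i * phi (cv_nu R X c i).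

Definition cvweight c (p : probability (XB X) R) : R :=
  \sum_(i | cv_nu R X c i == p) cv_lam R X c i.

(** Indexing by measures instead of positions lets two combinations be averaged over one common
    list. *)
Lemma cvavg_seq c (s : seq (probability (XB X) R)) phi :
  uniq s -> (forall i, cv_nu R X c i \in s) ->
  \sum_(p <- s) cvweight c p * phi p = cvavg c phi.
Proof.
move=> us cs; under eq_bigr do rewrite /cvweight big_mkcond mulr_suml.
rewrite exchange_big/=; apply: eq_bigr => i _.
rewrite (bigD1_seq _ (cs i) us)/= eqxx big1 ?addr0//.
by move=> p; rewrite eq_sym => /negbTE ->; rewrite mul0r.
Qed.

Lemma cvweight_ge0 act c p : @in_coE R G X act c -> 0 <= cvweight c p.
Proof. by move=> [l0 _ _ _]; apply: sumr_ge0 => i _; exact: ltW. Qed.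

Lemma cvweight_gt0 act c i : @in_coE R G X act c ->
  0 < cvweight c (cv_nu R X c i).
Proof.
move=> [l0 _ _ _]; rewrite /cvweight (bigD1 i)//= ltr_pwDl//.
by apply: sumr_ge0 => j _; exact: ltW.
Qed.

(** The two lists of components are merged without repetition, since [in_coE] demands distinct
    measures, and the weights are interpolated. Each weight stays positive because its measure
    occurs in at least one of the two lists. *)
Lemma in_coE_mix act c1 c2 (tau : R) : 0 < tau < 1 ->
  @in_coE R G X act c1 -> @in_coE R G X act c2 ->
  exists c, in_coE act c /\
    forall phi,
      cvavg c phi = cvavg c1 phi + tau * (cvavg c2 phi - cvavg c1 phi).
Proof.
move=> /andP[t0 t1] h1 h2.
pose s := undup (codom (cv_nu R X c1) ++ codom (cv_nu R X c2)).
have s1 i : cv_nu R X c1 i \in s by rewrite mem_undup mem_cat codom_f.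
have s2 i : cv_nu R X c2 i \in s by rewrite mem_undup mem_cat codom_f orbT.
have us : uniq s by exact: undup_uniq.
pose w p := (1 - tau) * cvweight c1 p + tau * cvweight c2 p.
pose c := Cvx R X (size s) (fun j => w (tnth (in_tuple s) j))
   (fun j => tnth (in_tuple s) j).
have cE phi : cvavg c phi = cvavg c1 phi + tau * (cvavg c2 phi - cvavg c1 phi).
  rewrite /cvavg/= -(big_tnth _ _ s xpredT (fun p => w p * phi p)).
  rewrite -/(cvavg c1 phi) -/(cvavg c2 phi).
  rewrite -(cvavg_seq _ us s1) -(cvavg_seq _ us s2).
  rewrite -sumrB mulr_sumr -big_split/=; apply: eq_bigr => p _.
  by rewrite /w; ring.
have st (j : 'I_(size s)) : (exists i, tnth (in_tuple s) j = cv_nu R X c1 i) \/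
    (exists i, tnth (in_tuple s) j = cv_nu R X c2 i).
  have : tnth (in_tuple s) j \in s by exact: mem_tnth.
  rewrite mem_undup mem_cat => /orP[] /codomP[i ->]; [left|right]; by exists i.
have sum1 (c' : cvx R X) : in_coE act c' -> cvavg c' (fun=> 1) = 1.
  by move=> [_ l1 _ _]; rewrite -[RHS]l1; apply: eq_bigr => i _; rewrite mulr1.
exists c; split => //; split => /=.
- move=> j; rewrite /w.
  have w1 := cvweight_ge0 (tnth (in_tuple s) j) h1.
  have w2 := cvweight_ge0 (tnth (in_tuple s) j) h2.
  case: (st j) => -[i ji].
    rewrite ltr_pwDl ?mulr_ge0 ?(ltW t0)//.
    by rewrite mulr_gt0 ?subr_gt0// ji (cvweight_gt0 _ h1).
  rewrite ltr_wpDl ?mulr_ge0 ?subr_ge0 ?(ltW t1)//.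
  by rewrite mulr_gt0// ji (cvweight_gt0 _ h2).
(* The total mass is the average of the constant 1. *)
- have := cE (fun=> 1); rewrite (sum1 _ h1) (sum1 _ h2) subrr mulr0 addr0 => c1E.
  rewrite -[RHS]c1E.
  by apply: eq_bigr => i _; rewrite mulr1.
- move=> j; case: (st j) => -[i ->]; [case: h1|case: h2] => _ _ h _; exact: h.
- move=> i j ij /eq_probability/eqP.
  rewrite !(tnth_nth (cv_nu R X c i)) nth_uniq// => /eqP/val_inj/eqP.
  by rewrite (negbTE ij).
Qed.

End mixtures.

(** * Integrals of continuous functions *)

Section integ_theory.
Variables (R : realType) (X : pmetricType R).
Hypothesis cX : compact [set: X].
Variable mu : probability (XB X) R.
Implicit Types f g : X -> R.

Lemma continuous_integrable f : continuous f ->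
  mu.-integrable setT (EFin \o (f : XB X -> R)).
Proof.
move=> cf; have [M M0 Mf] := continuous_bounded cX cf.
apply: measurable_bounded_integrable => //.
- by rewrite (le_lt_trans (probability_le1 _ _))// ltry.
- exact: continuous_measurable.
- exists M; split; first exact: num_real.
  by move=> N MN x _; rewrite /= (le_trans (Mf x))// ltW.
Qed.

Lemma integB f g : continuous f -> continuous g ->
  integ mu (fun x => f x - g x) = integ mu f - integ mu g.
Proof.
by move=> cf cg; apply: RintegralB => //; exact: continuous_integrable.
Qed.

Lemma integ_cst (M : R) : integ mu (fun=> M) = M.
Proof. by rewrite /integ integral_cst//= probability_setT mule1. Qed.

Lemma integ_le f g : continuous f -> continuous g -> (forall x, f x <= g x) ->
  integ mu f <= integ mu g.
Proof.
by move=> cf cg fg; apply: le_Rintegral => //; exact: continuous_integrable.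
Qed.

Lemma integ_norm f (M : R) : continuous f -> (forall x, `|f x| <= M) ->
  `|integ mu f| <= M.
Proof.
move=> cf fM; rewrite ler_norml; apply/andP; split.
  rewrite -[leLHS]integ_cst; apply: integ_le => //; first exact: cst_continuous.
  by move=> x; have := fM x; rewrite ler_norml => /andP[].
rewrite -[leRHS]integ_cst; apply: integ_le => //; first exact: cst_continuous.
by move=> x; have := fM x; rewrite ler_norml => /andP[].
Qed.

Lemma integ_sum m (a : 'I_m -> R) (phi : 'I_m -> X -> R) :
  (forall i, continuous (phi i)) ->
  integ mu (fun x => \sum_i a i * phi i x) = \sum_i a i * integ mu (phi i).
Proof.
move=> cphi; elim: (index_enum _) => [|i r IH].
  rewrite big_nil -[RHS]integ_cst; congr (integ mu _).
  by apply/funext => x; rewrite big_nil.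
have capi j : continuous (fun x => a j * phi j x).
  by move=> x; apply: cvgM; [exact: cvg_cst | exact: cphi].
rewrite big_cons -IH.
rewrite (_ : a i * _ = integ mu (fun x => a i * phi i x)); last first.
  by rewrite [RHS]RintegralZl//; exact: continuous_integrable.
have cs : continuous (fun x => \sum_(j <- r) a j * phi j x).
  exact: continuous_sumr.
rewrite [RHS](esym (RintegralD _ (continuous_integrable (capi i))
  (continuous_integrable cs)))//.
by congr (integ mu _); apply/funext => x; rewrite big_cons.
Qed.

End integ_theory.

(** * Lower limits at scale 0 and diagonal selection *)

Lemma liminf0_ge (R : realType) (g : R -> \bar R) (a : R) :
  (forall eta : R, 0 < eta -> \forall e \near 0^'+, ((a - eta)%:E <= g e)%E) ->
  (a%:E <= liminf0 g)%E.
Proof.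
move=> ag; apply/lee_addgt0Pr => eta eta0.
have [d /= d0 dP] := ag _ eta0.
rewrite -leeBlDr// -EFinB.
apply: le_ereal_sup_tmp; exists (ereal_inf [set g e | e in `]0, d[ ]).
  by exists d => //=; rewrite in_itv/= d0.
apply: le_ereal_inf_tmp => _ [e /= + <-]; rewrite in_itv/= => /andP[e0 ed].
by apply: dP => //=; rewrite sub0r normrN gtr0_norm.
Qed.

Lemma liminf0_gt (R : realType) (g : R -> \bar R) (a : R) :
  (a%:E < liminf0 g)%E -> \forall e \near 0^'+, (a%:E < g e)%E.
Proof.
move=> /ereal_sup_gt[_ [d + <-] ainf]; rewrite /= in_itv/= andbT => d0.
near=> e; apply: lt_le_trans ainf _; apply: ereal_inf_lbound.
by exists e => //=; rewrite in_itv/=; apply/andP; split; near: e;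
  [exact: nbhs_right_gt | exact: nbhs_right_lt].
Unshelve. all: by end_near. Qed.

Lemma diagonal_family (R : realType) (T : Type) (Q : T -> Prop)
    (P : nat -> R -> T -> Prop) :
  (exists c, Q c) ->
  (forall k, \forall e \near (0 : R)^'+, exists2 c, Q c & P k e c) ->
  exists2 fam : R -> T, (forall e, Q (fam e)) &
    forall n, \forall e \near 0^'+, exists2 k, (n <= k)%N & P k e (fam e).
Proof.
(* At scale [e] use the largest [k <= 1/e] for which [P k e] is satisfiable. *)
move=> [c0 Qc0] near_ex.
pose N (e : R) := Num.truncn e^-1.
have sel e : exists c, Q c /\ forall n, (n <= N e)%N ->
    (exists2 c, Q c & P n e c) -> exists2 k, (n <= k)%N & P k e c.
  pose good n := `[< (n <= N e)%N /\ exists2 c, Q c & P n e c >].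
  (* If no admissible level is satisfiable at this scale, the default [c0] meets the requirement
     vacuously. *)
  have [exg|nog] := pselect (exists n, good n); last first.
    by exists c0; split => // n nN ?; case: nog; exists n; exact/asboolP.
  have ubg n : good n -> (n <= N e)%N by move=> /asboolP[].
  case: (ex_maxnP exg ubg) => k /asboolP[_ [c Qc Pc]] kmax.
  by exists c; split => // n nN nex; exists k => //; apply: kmax; exact/asboolP.
have [fam famP] := choice sel.
exists fam => [e|n]; first exact: (famP e).1.
near=> e; apply: (famP e).2; last by near: e; exact: near_ex.
have e0 : 0 < e by near: e; exact: nbhs_right_gt.
rewrite truncn_ge_nat ?invr_ge0 ?(ltW e0)//.
have en : e <= n.+1%:R^-1 by near: e; apply: nbhs_right_le; rewrite invr_gt0.
apply: (@le_trans _ _ n.+1%:R); first by rewrite ler_nat.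
by rewrite -[leLHS]invrK lef_pV2 ?posrE ?invr_gt0.
Unshelve. all: by end_near. Qed.

(** * Approximating [mu0] with entropy rate close to [a] *)

Section duality.
Variables (R : realType) (G : choiceType) (X : pmetricType R).
Variables (act : G -> X -> X) (Fs : nat -> {fset G}).
Hypothesis cX : compact [set: X].
Implicit Types (mu : probability (XB X) R) (c : cvx R X) (f : X -> R).

Local Notation cvinteg c f := (cvavg c (fun nu => integ nu f)).
Local Notation entropy_rate c e := (Fval act Fs c e / ln e^-1).

(** A strict bound below the supremum is exceeded by the lower limit along a single family; weak
    convergence of that family controls finitely many test functions together. *)
Lemma mdim_mu_gt mu (t eta : R) m (phi : 'I_m -> X -> R) :
  (t%:E < mdim_mu act Fs mu)%E -> 0 < eta ->
  (forall i, continuous (phi i)) ->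
  \forall e \near 0^'+, exists c, [/\ in_coE act c,
    forall i, `|cvinteg c (phi i) - integ mu (phi i)| <= eta
    & t <= entropy_rate c e].
Proof.
move=> /ereal_sup_gt[_ [fam [famE famW] <-] /liminf0_gt tlim] eta0 cphi.
have wi : \forall e \near 0^'+, forall i,
    `|cvinteg (fam e) (phi i) - integ mu (phi i)| <= eta.
  apply: filter_forall => i.
  have /cvgrPdist_le/(_ _ eta0) := famW _ (cphi i).
  by apply: filterS => e; rewrite distrC.
near=> e; exists (fam e); split.
- by apply: famE; near: e; exact: nbhs_right_gt.
- by near: e.
- by rewrite -lee_fin ltW//; near: e.
Unshelve. all: by end_near. Qed.

Lemma cvavg_norm c (phi : probability (XB X) R -> R) (M : R) : in_coE act c ->
  (forall nu, `|phi nu| <= M) -> `|cvavg c phi| <= M.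
Proof.
move=> [l0 l1 _ _] phiM; rewrite -[M]mul1r -l1 mulr_suml.
apply: le_trans (ler_norm_sum _ _ _) _; apply: ler_sum => i _.
by rewrite normrM gtr0_norm// ler_pM2l.
Qed.

Variables (mu0 : probability (XB X) R) (M a : R).
(** The form in which the variational principle enters: [mu] attains the maximum for [f], and [M]
    will be the mean dimension at the zero potential. *)
Hypothesis dual : forall f, continuous f -> exists mu (t : R),
  [/\ mdim_mu act Fs mu = t%:E, t <= M & a + integ mu0 f <= t + integ mu f].

Lemma approx_finite m (phi : 'I_m -> X -> R) (d : R) : 0 < d ->
  (forall i, continuous (phi i)) -> (forall i x, 0 <= phi i x <= 1) ->
  \forall e \near 0^'+, exists c, [/\ in_coE act c,
    forall i, `|cvinteg c (phi i) - integ mu0 (phi i)| <= d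
    & a - d <= entropy_rate c e].
Proof.
move=> d0 cphi phi01.
(* The convex set of limiting pairs. The witness [c] may change with [e], and the slack [eta] admits
   values [t] that are only suprema of entropy rates. *)
pose K (x : 'I_m -> R) (t : R) := [/\ t <= M, forall i, `|x i| <= 1 &
  forall eta : R, 0 < eta -> \forall e \near 0^'+, exists c,
    [/\ in_coE act c,
        forall i, `|cvinteg c (phi i) - integ mu0 (phi i) - x i| <= eta
      & t - eta <= entropy_rate c e]].
have Kb x t : K x t -> t <= M /\ forall i, `|x i| <= 1 by case.
have Kconv x t y s tau : 0 < tau < 1 -> K x t -> K y s ->
    K (fun i => x i + tau * (y i - x i)) (t + tau * (s - t)).
  move=> tau01 [tM x1 Kx] [sM y1 Ky]; have /andP[tau0 tau1] := tau01.
  have mixle (u v w z : R) : u <= w -> v <= z ->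
      u + tau * (v - u) <= w + tau * (z - w).
    move=> uw vz; have : (1 - tau) * u <= (1 - tau) * w.
      by rewrite ler_pM2l// subr_gt0.
    have : tau * v <= tau * z by rewrite ler_pM2l.
    lra.
  have mixn (u v w : R) : `|u| <= w -> `|v| <= w -> `|u + tau * (v - u)| <= w.
    rewrite !ler_norml => /andP[? ?] /andP[? ?].
    have : - w + tau * (- w - - w) <= u + tau * (v - u) by exact: mixle.
    have : u + tau * (v - u) <= w + tau * (w - w) by exact: mixle.
    by rewrite !subrr !mulr0 !addr0 => -> ->.
  split.
  - by have := mixle _ _ _ _ tM sM; rewrite subrr mulr0 addr0.
  - by move=> i; exact: mixn.
  (* Witnesses are mixed at the same scale [e], where both the integrals and [Fval] are affine in
     the combination. *)
  move=> eta eta0; have := Kx _ eta0; have := Ky _ eta0.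
  apply: filterS2 => e [c2 [c2E c2x c2t]] [c1 [c1E c1x c1t]].
  have [c [cE cavg]] := in_coE_mix tau01 c1E c2E.
  exists c; split => //.
    move=> i; rewrite cavg; have := mixn _ _ _ (c1x i) (c2x i).
    by congr (`|_| <= _); ring.
  have := mixle _ _ _ _ c1t c2t.
  rewrite [Fval _ _ c _](cavg (fun nu => heps act Fs nu e)) -!/(Fval _ _ _ _).
  rewrite /Fval /cvavg; set F1 := \sum_i _; set F2 := \sum_i _; set L := ln _.
  lra.
(* The linear form [b] corresponds to the potential [- \sum_i b i * phi i]; the sign turns the
   inequality of [dual] into the required lower bound on [t]. *)
have Ka b : exists x t, K x t /\ a + \sum_i b i * x i <= t.
  have cf : continuous (fun x => \sum_i - b i * phi i x).
    apply: continuous_sumr => i x; apply: cvgM; first exact: cvg_cst.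
    exact: cphi.
  have [mu [t [mut tM ale]]] := dual cf.
  exists (fun i => integ mu (phi i) - integ mu0 (phi i)), t; split; last first.
    move: ale; rewrite !integ_sum//.
    have -> : \sum_i b i * (integ mu (phi i) - integ mu0 (phi i)) =
      \sum_i - b i * integ mu0 (phi i) - \sum_i - b i * integ mu (phi i).
      by rewrite -sumrB; apply: eq_bigr => i _; ring.
    lra.
  split => //.
    have I01 nu i : 0 <= integ nu (phi i) <= 1.
      rewrite -[X in X <= _](integ_cst nu) -[X in _ <= _ <= X](integ_cst nu).
      by apply/andP; split; apply: integ_le => //;
        try exact: cst_continuous; move=> x; case/andP: (phi01 i x).
    move=> i; have /andP[? ?] := I01 mu i; have /andP[? ?] := I01 mu0 i.
    by rewrite ler_norml; lra.
  move=> eta eta0.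
  have tlt : ((t - eta)%:E < mdim_mu act Fs mu)%E.
    by rewrite mut lte_fin; lra.
  have := mdim_mu_gt tlt eta0 cphi.
  apply: filterS => e [c [cE cphii ct]]; exists c; split => // i.
  by have := cphii i; congr (`|_| <= _); ring.
(* Half of [d] pays for the distance from [x] to 0, half for the approximation of [(x, t)] by a
   witness. *)
have d20 : 0 < d / 2 by rewrite divr_gt0.
have [x [t [[_ _ Kx] ta xd]]] := frank_wolfe Kb Kconv Ka d20.
have := Kx _ d20; apply: filterS => e [c [cE cx ct]]; exists c; split => //.
  move=> i; have := cx i; have := xd i; rewrite !ler_norml.
  by move=> /andP[? ?] /andP[? ?]; lra.
by apply: le_trans ct; lra.
Qed.

(** Every [f] is interpolated from its values at the centres of a partition of unity of mesh [r].
    The witness [c] is chosen before [f], so it serves all test functions simultaneously. *)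
Lemma approx_continuous (r : R) : 0 < r ->
  \forall e \near 0^'+, exists2 c, in_coE act c &
    (forall f (B w : R), continuous f -> (forall x, `|f x| <= B) ->
       (forall x y, mdist x y < r -> `|f x - f y| <= w) ->
       `|cvinteg c f - integ mu0 f| <= 2 * w + B * r) /\
    a - r <= entropy_rate c e.
Proof.
move=> r0; have [m [p [phi [cphi phi0 phi1 phip]]]] := partition_of_unity cX r0.
(* The [m] errors, each at most [B * (r / m.+1%:R)], then add up to at most [B * r]. *)
have d0 : 0 < r / m.+1%:R by rewrite divr_gt0.
have phi01 i x : 0 <= phi i x <= 1.
  rewrite phi0/= -(phi1 x) (bigD1 i)//= lerDl; apply: sumr_ge0 => j _.
  exact: phi0.
have := approx_finite d0 cphi phi01; apply: filterS => e [c [cE cphii ca]].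
exists c => //; split; last first.
  apply: le_trans ca; rewrite lerD2l lerN2 ler_pdivrMr// ler_peMr ?ler1n//.
  exact: ltW.
move=> f B w cf fB fw.
pose g x := \sum_i f (p i) * phi i x.
have cg : continuous g.
  apply: continuous_sumr => i x; apply: cvgM; first exact: cvg_cst.
  exact: cphi.
(* Only the centres within [r] of [x] contribute, and there [f] differs from [f x] by at most
   [w]. *)
have fg x : `|f x - g x| <= w.
  have -> : f x - g x = \sum_i (f x - f (p i)) * phi i x.
    rewrite /g -[f x in LHS]mulr1 -(phi1 x) mulr_sumr -sumrB.
    by apply: eq_bigr => i _; rewrite mulrBl.
  rewrite -[w]mulr1 -(phi1 x) mulr_sumr.
  apply: le_trans (ler_norm_sum _ _ _) _; apply: ler_sum => i _.
  rewrite normrM (ger0_norm (phi0 i x)).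
  have [->|/phip xp] := eqVneq (phi i x) 0; first by rewrite !mulr0.
  by apply: ler_wpM2r; [exact: phi0 | exact: fw].
have cfg : continuous (fun x => f x - g x).
  by move=> x; apply: cvgB; [exact: cf | exact: cg].
have h1 : `|cvinteg c f - cvinteg c g| <= w.
  rewrite /cvavg -sumrB; under eq_bigr do rewrite -mulrBr -(integB cX _ cf cg).
  pose phi_fg nu := integ nu (fun x => f x - g x).
  by apply: (cvavg_norm (phi := phi_fg) cE) => nu; exact: integ_norm.
have h2 : `|integ mu0 f - integ mu0 g| <= w.
  by rewrite -(integB cX _ cf cg); exact: integ_norm.
have h3 : `|cvinteg c g - integ mu0 g| <= B * r.
  have B0 : 0 <= B by apply: le_trans (fB point).
  have -> : cvinteg c g - integ mu0 g =
      \sum_i f (p i) * (cvinteg c (phi i) - integ mu0 (phi i)).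
    under eq_bigr do rewrite mulrBr; rewrite sumrB -integ_sum//; congr (_ - _).
    rewrite /cvavg; under [RHS]eq_bigr do rewrite mulr_sumr.
    rewrite exchange_big/=; apply: eq_bigr => j _.
    rewrite [integ _ g]integ_sum// mulr_sumr.
    by apply: eq_bigr => i _; ring.
  apply: le_trans (ler_norm_sum _ _ _) _.
  apply: (@le_trans _ _ (\sum_(i < m) B * (r / m.+1%:R))).
    by apply: ler_sum => i _; rewrite normrM ler_pM.
  rewrite sumr_const card_ord -[leLHS]mulr_natr -mulrA ler_wpM2l//.
  rewrite mulrAC ler_pdivrMr// ler_pM2l// ler_nat//.
by move: h1 h2 h3; rewrite !ler_norml => /andP[? ?] /andP[? ?] /andP[? ?]; lra.
Qed.

Lemma mdim_mu_ge : (a%:E <= mdim_mu act Fs mu0)%E.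
Proof.
pose r (k : nat) : R := k.+1%:R^-1.
have r0 k : 0 < r k by rewrite invr_gt0.
have rle n k : (n <= k)%N -> r k <= r n.
  by move=> nk; rewrite lef_pV2 ?posrE// ler_nat.
have rsmall (z : R) : 0 < z -> exists n, r n < z.
  move=> z0; exists (Num.truncn z^-1).
  rewrite /r -[z]invrK ltf_pV2 ?posrE ?invr_gt0//.
  by rewrite invrK; exact: truncnS_gt.
have [c0 c0E] : exists c, in_coE act c.
  have /filter_ex[|e [c cE _]] := approx_continuous ltr01.
    exact: at_right_proper_filter.
  by exists c.
have [fam famE famP] := diagonal_family (ex_intro _ c0 c0E)
  (fun k => approx_continuous (r0 k)).
apply: le_ereal_sup_tmp.
exists (liminf0 (fun e => (entropy_rate (fam e) e)%:E)).
  exists fam => //; split=> [e _|f cf]; first exact: famE.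
  apply/cvgrPdist_le => eta eta0.
  have [B B0 fB] := continuous_bounded cX cf.
  have eta40 : 0 < eta / 4 by rewrite divr_gt0.
  have [s s0 sf] := continuous_uniform cX cf eta40.
  (* Beyond [n1] the mesh is fine enough for the oscillation bound [eta / 4], which counts twice;
     beyond [n2] the term [B * r k] is at most [eta / 2]. *)
  have [n1 n1s] := rsmall _ s0.
  have [n2 n2s] := rsmall (eta / 2 / B) ltac:(by rewrite !divr_gt0).
  have := famP (maxn n1 n2); apply: filterS => e [k].
  rewrite geq_max => /andP[/rle k1 /rle k2] [/(_ f B (eta / 4) cf fB) + _].
  rewrite distrC => famk; apply: le_trans (famk _) _.
    by move=> x y xy; apply/ltW/sf; lra.
  have : B * r k <= eta / 2 by rewrite mulrC -ler_pdivlMr//; lra.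
  lra.
apply: liminf0_ge => eta eta0; have [n neta] := rsmall _ eta0.
have := famP n; apply: filterS => e [k /rle kn [_ ak]].
by rewrite lee_fin; apply: le_trans ak; lra.
Qed.

End duality.

(** * From the variational principle to the duality formula *)

Unset Implicit Arguments.
Set Strict Implicit.
Set Printing Implicit Defensive.

Theorem theorem3p35 (R : realType) (G : countType) (L : group_law G)
  (X : pmetricType R) (act : G -> X -> X) (Fs : nat -> {fset G}) :
  infinite_set [set: G] ->
  compact [set: X] ->
  is_gaction L act ->
  folner R L Fs -> tempered R L Fs ->
  (mdimM act (fun=> 0%R) Fs < +oo)%E ->
  (forall f : X -> R, continuous f ->
     (exists mu : probability (XB X) R, inv_measure act mu /\
        mdimM act f Fs = (mdim_mu act Fs mu + (integ mu f)%:E)%E) /\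
     (forall mu : probability (XB X) R, inv_measure act mu ->
        (mdim_mu act Fs mu + (integ mu f)%:E <= mdimM act f Fs)%E)) ->
  forall mu0 : probability (XB X) R, inv_measure act mu0 ->
    mdim_mu act Fs mu0 =
    ereal_inf [set (mdimM act f Fs - (integ mu0 f)%:E)%E
              | f in [set f : X -> R | continuous f]].
Proof.
move=> _ cX _ _ _ mdim_lty varprinc mu0 inv0.
set I := ereal_inf _.
have c0 : continuous (fun _ : X => 0 : R) by exact: cst_continuous.
have mdim_mu_le mu : inv_measure act mu ->
    (mdim_mu act Fs mu <= mdimM act (fun=> 0%R) Fs)%E.
  move=> invmu; have := (varprinc _ c0).2 mu invmu.
  by rewrite integ_cst adde0.
have Ile f : continuous f -> (I <= mdimM act f Fs - (integ mu0 f)%:E)%E.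
  by move=> cf; apply: ereal_inf_lbound; exists f.
have I0 : (I <= mdimM act (fun=> 0%R) Fs)%E.
  by have := Ile _ c0; rewrite integ_cst sube0.
apply/eqP; rewrite eq_le; apply/andP; split.
  apply: le_ereal_inf_tmp => _ [f cf <-].
  by have := (varprinc f cf).2 _ inv0; rewrite -leeBrDr.
(* An infimum [-oo] gives the bound trivially, and [+oo] contradicts finiteness at the zero
   potential, so the real case carries the content. *)
case IE : I => [a| |]; last by rewrite leNye.
- have mdim0 : mdimM act (fun=> 0%R) Fs \is a fin_num.
    by rewrite fin_numElt mdim_lty andbT (lt_le_trans _ I0)// IE ltNyr.
  apply: (@mdim_mu_ge R G X act Fs cX mu0 (fine (mdimM act (fun=> 0%R) Fs)) a).
  move=> f cf; have [[mu [invmu fE]] _] := varprinc f cf.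
  have := Ile f cf; rewrite IE fE leeBrDr// -EFinD.
  have := mdim_mu_le _ invmu; rewrite -[leRHS]fineK//.
  (* The value [+oo] is excluded by the upper bound [tM], and [-oo] by the lower bound [ta], whose
     left side is real. *)
  case muE : (mdim_mu act Fs mu) => [t| |] //= tM ta.
  by exists mu, t; split => //; rewrite -lee_fin.
- by move: I0; rewrite IE leye_eq => /eqP I0; rewrite I0 in mdim_lty.
Qed.
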